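(* Suppose that $B$ is a real-valued function of $CZ$ such that $$1-\mathbb{E}_\nu(B(CZ))\ge\max_{dz}\nu(d|z)\quad\text{for all }\nu\in\mathcal{C}.$$ Let $\alpha<1$, $\beta>0$, $0\le\lambda\le1$ and define $$F(CZ)=(1-\alpha)^{-\beta}\left(1+\beta\frac{B(CZ)-\alpha}{1-\alpha}\right).$$ If $F'=1+\lambda(F-1)\ge0$, then $F'$ is a PEF with power $\beta$ for $\mathcal{C}$ satisfying $$F'\ge0\quad\text{and}\quad\mathbb{E}_\nu\bigl(F'(CZ)\max_{dz}\nu(d|z)^\beta\bigr)\le1\ \text{ for }\nu\in\mathrm{Extr}(\mathcal{C}).$$
   Context: $C,Z$ are random variables with finite value spaces and $D$ is a function of $C$. $\mathcal{C}$ is a set of distributions of $CZ$ and $\mathrm{Extr}(\mathcal{C})$ its set of extreme points. Maxima of $\nu(d|z)$ are over values $d$ of $D$ and values $z$ of $Z$ with $\nu(z)>0$. Expectations are sums over values of positive probability only. PEF: a probability estimation factor with power $\beta>0$ for $\mathcal{C}$ (and $D|Z$) is a non-negative function $G=G(CZ)$ such that $\mathbb{E}_\nu(G(CZ)\,\nu(D|Z)^\beta)\le1$ for all $\nu\in\mathcal{C}$. *)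

(* Defs.v *)
From HB Require Import structures.
From mathcomp Require Import all_boot all_order all_algebra.
From mathcomp Require Import classical_sets reals exp.

Set Implicit Arguments.
Unset Strict Implicit.
Unset Printing Implicit Defensive.

Import Order.TTheory GRing.Theory Num.Theory.

Local Open Scope classical_set_scope.
Local Open Scope ring_scope.

Record fdist (R : realType) (T : finType) := FDist {
  fdist_fun :> {ffun T -> R};
  fdist_ge0 : forall x, 0 <= fdist_fun x;
  fdist_sum1 : \sum_x fdist_fun x = 1
}.

Definition expect (R : realType) (T : finType) (nu : fdist R T) (X : T -> R) : R :=
  \sum_(x | 0 < nu x) nu x * X x.

(* The set [A] is not required to be convex. *)
Definition extreme_points (R : realType) (T : finType) (A : set (fdist R T)) :
    set (fdist R T) :=
  [set nu | A nu /\ forall (mu1 mu2 : fdist R T) (t : R),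
     A mu1 -> A mu2 -> 0 < t -> t < 1 ->
     (forall x, nu x = t * mu1 x + (1 - t) * mu2 x) -> mu1 = mu2].

(* Below, [CT], [ZT] and [DT] are the value spaces of C, Z and D; [nu] is the
   joint distribution of CZ, and D is the function [D] of C. *)

Definition probZ (R : realType) (CT ZT : finType) (nu : fdist R (CT * ZT)%type)
    (z : ZT) : R :=
  \sum_(c : CT) nu (c, z).

Definition probDZ (R : realType) (CT ZT DT : finType)
    (nu : fdist R (CT * ZT)%type) (D : CT -> DT) (d : DT) (z : ZT) : R :=
  \sum_(c : CT | D c == d) nu (c, z).

(* nu(d|z), meaningful only when nu(z) > 0. *)
Definition condDZ (R : realType) (CT ZT DT : finType)
    (nu : fdist R (CT * ZT)%type) (D : CT -> DT) (d : DT) (z : ZT) : R :=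
  probDZ nu D d z / probZ nu z.

(* The default value 0 of the big operator is harmless: the nu(d|z) are
   nonnegative and the family they range over is nonempty. *)
Definition max_condDZ (R : realType) (CT ZT DT : finType)
    (nu : fdist R (CT * ZT)%type) (D : CT -> DT) : R :=
  \big[Num.max/0]_(dz : DT * ZT | 0 < probZ nu dz.2) condDZ nu D dz.1 dz.2.

Definition is_PEF (R : realType) (CT ZT DT : finType)
    (CC : set (fdist R (CT * ZT)%type)) (D : CT -> DT) (beta : R)
    (G : CT * ZT -> R) : Prop :=
  [/\ 0 < beta,
      forall cz, 0 <= G cz &
      forall nu, CC nu ->
        expect nu (fun cz => G cz * condDZ nu D (D cz.1) cz.2 `^ beta) <= 1].

(* Main.v *)
(* The tangent-line inequality [x^beta (1 + beta (1 - x)) <= 1], taken at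
   [x = M / (1 - alpha)] with [M = max nu(d|z)], gives [E(F) M^beta <= 1], since
   the hypothesis bounds [E(B)] by [1 - M].  As [M <= 1], also [M^beta <= 1],
   and [E(F') M^beta] is a convex combination of these two quantities.  The PEF
   inequality follows because [nu(d|z) <= M]. *)
Require Import Defs.
From HB Require Import structures.
From mathcomp Require Import all_boot all_order all_algebra.
From mathcomp Require Import classical_sets reals exp.
From mathcomp Require Import ring lra.

Set Implicit Arguments.
Unset Strict Implicit.
Unset Printing Implicit Defensive.

Import Order.TTheory GRing.Theory Num.Theory.

Local Open Scope classical_set_scope.
Local Open Scope ring_scope.

Lemma powR_tangent_le1 (R : realType) (x beta : R) :
  0 <= x -> 0 < beta -> x `^ beta * (1 + beta * (1 - x)) <= 1.
Proof.
rewrite le_eqVlt => /predU1P[<-|x0] b0; first by rewrite powR0 ?gt_eqF// mul0r.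
have xpow0 := powR_gt0 beta x0.
rewrite -ler_pdivlMl// mulr1 -powRN /powR gt_eqF//.
apply: le_trans (expR_ge1Dx _); rewrite lerD2l mulNr -mulrN ler_wpM2l ?(ltW b0)//.
by have := expR_ge1Dx (ln x); rewrite lnK ?posrE//; lra.
Qed.

Section Expectation.
Variables (R : realType) (T : finType) (nu : fdist R T).

Lemma expectE (X : T -> R) : expect nu X = \sum_x nu x * X x.
Proof.
rewrite /expect big_mkcond; apply: eq_bigr => x _.
by case: ltgtP (fdist_ge0 nu x) => // <-; rewrite mul0r.
Qed.

Lemma expect_affine (a b : R) (X : T -> R) :
  expect nu (fun x => a + b * X x) = a + b * expect nu X.
Proof.
rewrite !expectE mulr_sumr -[in RHS](mulr1 a) -(fdist_sum1 nu) mulr_sumr.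
by rewrite -big_split; apply: eq_bigr => x _ /=; ring.
Qed.

Lemma expectMr (a : R) (X : T -> R) :
  expect nu (fun x => X x * a) = expect nu X * a.
Proof. by rewrite /expect mulr_suml; apply: eq_bigr => x _; rewrite mulrA. Qed.

Lemma le_expect (X Y : T -> R) :
  (forall x, 0 < nu x -> X x <= Y x) -> expect nu X <= expect nu Y.
Proof. by move=> XY; apply: ler_sum => x nx; rewrite ler_pM2l ?XY. Qed.

End Expectation.

Section ConditionalProbability.
Variables (R : realType) (CT ZT DT : finType).
Variables (nu : fdist R (CT * ZT)%type) (D : CT -> DT).

(** Ensures that at every point of the support the value nu(d|z) is among those over which
    [max_condDZ] ranges. *)
Lemma probZ_gt0 (cz : CT * ZT) : 0 < nu cz -> 0 < probZ nu cz.2.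
Proof.
case: cz => c z ncz; apply: lt_le_trans ncz _.
rewrite /probZ (bigD1 c)//= lerDl sumr_ge0// => c' _; exact: fdist_ge0.
Qed.

Lemma probDZ_le_probZ (d : DT) (z : ZT) : probDZ nu D d z <= probZ nu z.
Proof.
rewrite /probZ (bigID (fun c => D c == d))//= lerDl sumr_ge0// => c _.
exact: fdist_ge0.
Qed.

Lemma condDZ_ge0 (d : DT) (z : ZT) : 0 <= condDZ nu D d z.
Proof. by rewrite divr_ge0 ?sumr_ge0// => c _; apply: fdist_ge0. Qed.

Lemma max_condDZ_ge0 : 0 <= max_condDZ nu D.
Proof. exact: bigmax_ge_id. Qed.

Lemma max_condDZ_le1 : max_condDZ nu D <= 1.
Proof.
apply: bigmax_le => // -[d z] /= nz.
by rewrite ler_pdivrMr// mul1r probDZ_le_probZ.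
Qed.

Lemma condDZ_le_max (d : DT) (z : ZT) :
  0 < probZ nu z -> condDZ nu D d z <= max_condDZ nu D.
Proof.
move=> nz.
exact: (le_bigmax_cond 0 (fun dz : DT * ZT => condDZ nu D dz.1 dz.2)
  (j := (d, z))).
Qed.

End ConditionalProbability.

Theorem theorem44 (R : realType) (CT ZT DT : finType) (D : CT -> DT)
    (CC : set (fdist R (CT * ZT)%type)) (B : CT * ZT -> R)
    (hB : forall nu, CC nu -> max_condDZ nu D <= 1 - expect nu B)
    (alpha beta lambda : R) (halpha : alpha < 1) (hbeta : 0 < beta)
    (hlambda0 : 0 <= lambda) (hlambda1 : lambda <= 1) :
  let F := fun cz : CT * ZT =>
    (1 - alpha) `^ (- beta) * (1 + beta * ((B cz - alpha) / (1 - alpha))) in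
  let F' := fun cz : CT * ZT => 1 + lambda * (F cz - 1) in
  (forall cz, 0 <= F' cz) ->
  [/\ is_PEF CC D beta F',
      forall cz, 0 <= F' cz &
      forall nu, extreme_points CC nu ->
        expect nu (fun cz => F' cz * max_condDZ nu D `^ beta) <= 1].
Proof.
move=> F F' F'_ge0.
pose M (nu : fdist R (CT * ZT)%type) := max_condDZ nu D.
have ga : 0 < 1 - alpha by rewrite subr_gt0.
have EF nu : CC nu -> M nu `^ beta * expect nu F <= 1.
  move=> /hB; rewrite -/(M nu) => MB.
  have M0 : 0 <= M nu := max_condDZ_ge0 nu D.
  have -> : expect nu F = (1 - alpha) `^ (- beta) *
      (1 + beta * ((expect nu B - alpha) / (1 - alpha))).
    set k := _ `^ _.
    (* [F] is affine in [B]; splitting off its constant term lets the expectation pass through to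
       [B]. *)
    transitivity (expect nu (fun cz => k * (1 - beta * (alpha / (1 - alpha)))
        + k * (beta / (1 - alpha)) * B cz)).
      by apply: eq_bigr => cz _; rewrite /F -/k; congr (_ * _); ring.
    by rewrite expect_affine; ring.
  have u0 : 0 <= M nu / (1 - alpha) by rewrite divr_ge0 ?(ltW ga).
  apply: le_trans (powR_tangent_le1 u0 hbeta).
  rewrite powRM ?invr_ge0 ?(ltW ga)// -powR_inv1 ?(ltW ga)// -powRrM mulN1r.
  rewrite powR_inv1 ?(ltW ga)// mulrA ler_wpM2l ?mulr_ge0 ?powR_ge0//.
  rewrite lerD2l ler_wpM2l ?(ltW hbeta)// ler_pdivrMr// mulrBl mul1r.
  by rewrite divfK ?gt_eqF//; lra.
(* Proved on all of [CC], this bound serves both the extreme points and the PEF inequality. *)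
have EF'max nu : CC nu -> expect nu (fun cz => F' cz * M nu `^ beta) <= 1.
  move=> nuC; rewrite expectMr.
  have -> : expect nu F' = 1 - lambda + lambda * expect nu F.
    by rewrite -expect_affine; apply: eq_bigr => cz _; rewrite /F'; congr (_ * _); ring.
  have Mb1 : M nu `^ beta <= 1.
    have -> : 1 = 1 `^ beta :> R by rewrite powR1.
    rewrite ge0_ler_powR ?nnegrE ?(ltW hbeta)//.
      exact: max_condDZ_ge0.
    exact: max_condDZ_le1.
  have := EF nu nuC; nra.
split=> // [|nu [/EF'max//]].
split=> // nu nuC; apply: le_trans (EF'max nu nuC).
(* The comparison is pointwise on the support: [F' >= 0] keeps its direction, and powers with
   exponent [beta] are monotone on nonnegative reals. *)
apply: le_expect => cz /probZ_gt0 nz; rewrite ler_wpM2l//.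
rewrite ge0_ler_powR ?nnegrE ?(ltW hbeta) ?condDZ_ge0 ?max_condDZ_ge0//.
exact: condDZ_le_max.
Qed.
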